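(* Let $R$ be an infinite commutative integral domain with identity and let $n\geqslant 2$ be an integer. Let $p\colon R^n\to R$ be a polynomial function of degree $\leqslant 1$. Then $(R,p)$ is an $n$-ary group if and only if $p$ is of one of the following two types: (iv) $p(x_1,\ldots,x_n)=c+\sum_{i=1}^n x_i$, where $c\in R$; (v) (if $n\geqslant 3$) $p(x_1,\ldots,x_n)=\sum_{i=1}^n\omega^{i-1}x_i$, where $\omega\in R\setminus\{1\}$ satisfies $\omega^{n-1}=1$. Moreover, for every $x\in R$ the skew element to $x$ is $\overline{x}=(2-n)x-c$ in type (iv) and $\overline{x}=x$ in type (v).
   Context: For a nonempty set $G$, a function $f\colon G^n\to G$ is associative if for every $i\in\{1,\ldots,n-1\}$ and all $x_1,\ldots,x_{2n-1}\in G$, $$f(x_1,\ldots,x_{i-1},f(x_i,\ldots,x_{i+n-1}),x_{i+n},\ldots,x_{2n-1})=f(x_1,\ldots,x_i,f(x_{i+1},\ldots,x_{i+n}),x_{i+n+1},\ldots,x_{2n-1});$$ then $(G,f)$ is an $n$-ary semigroup. The pair $(G,f)$ is an $n$-ary quasigroup if for every $a_1,\ldots,a_n,b\in G$ and every $i\in\{1,\ldots,n\}$ the equation $f(a_1,\ldots,a_{i-1},z,a_{i+1},\ldots,a_n)=b$ has a unique solution $z\in G$. An $n$-ary group is an $n$-ary quasigroup that is also an $n$-ary semigroup. In an $n$-ary group, the skew element $\overline{x}$ to $x$ is the element defined by $f(x,\ldots,x,\overline{x})=x$. A polynomial function $R^n\to R$ is a function induced by a polynomial in $R[x_1,\ldots,x_n]$;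 since $R$ is an infinite integral domain, polynomial functions are identified with polynomials, and the degree is the total degree. *)

(* Defs.v *)
From mathcomp Require Export all_boot all_order all_algebra.
From mathcomp Require Export mpoly.
From mathcomp Require Export classical_sets cardinality.

Set Implicit Arguments.
Unset Strict Implicit.
Unset Printing Implicit Defensive.

Import GRing.Theory.

Section NaryOperations.
Variables (n : nat) (G : Type).
Implicit Type f : {ffun 'I_n -> G} -> G.

(* f(x_0, .., x_(i-1), f(x_i, .., x_(i+n-1)), x_(i+n), .., x_(2n-2)), with
   0-based indices. The 2n - 1 variables are indexed by 'I_(2 * n.-1).+1; for
   i < n every index fed to inord is at most 2 * n.-1, so inord never takes
   its default value. *)
Definition nary_nest f (i : nat) (x : {ffun 'I_(2 * n.-1).+1 -> G}) : G :=
  f [ffun j : 'I_n =>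
       if (j < i)%N then x (inord j)
       else if j == i :> nat then f [ffun k : 'I_n => x (inord (i + k))]
       else x (inord (j + n.-1))].

Definition nary_associative f : Prop :=
  forall i : nat, (i.+1 < n)%N ->
  forall x : {ffun 'I_(2 * n.-1).+1 -> G}, nary_nest f i x = nary_nest f i.+1 x.

Definition nary_quasigroup f : Prop :=
  forall (a : {ffun 'I_n -> G}) (b : G) (i : 'I_n),
  exists! z : G, f [ffun j => if j == i then z else a j] = b.

Definition nary_group f : Prop := nary_quasigroup f /\ nary_associative f.

(* f(x, .., x, y) = x *)
Definition nary_skew f (x y : G) : Prop :=
  f [ffun j : 'I_n => if j.+1 == n then y else x] = x.

End NaryOperations.

(* msize P is the total degree of P plus one, and 0 if P = 0 *)
Definition polyfun_degree_le (n : nat) (R : idomainType) (d : nat)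
    (p : {ffun 'I_n -> R} -> R) : Prop :=
  exists2 P : {mpoly R[n]}, (msize P <= d.+1)%N & forall x, p x = P.@[x].

(* Main.v *)
(** Write [p = c + \sum_i a_i x_i] with 0-based indices. Comparing coefficients
    in the first associativity law alone gives [a_0 = 1], [a_k = a_1 a_(k-1)],
    [a_(n-1) = 1] and [c = a_1 c], so [a_i = w^i] with [w^(n-1) = 1], and
    [c = 0] unless [w = 1]. Conversely, for such [a] and [c] every nested
    composition equals [2c + \sum_m w^m x_m], wherever the inner [p] stands. *)
Require Import Defs.
From mathcomp Require Import zify ring.

Set Implicit Arguments.
Unset Strict Implicit.
Unset Printing Implicit Defensive.

Import GRing.Theory.
Local Open Scope ring_scope.

(** Coefficients are compared at each monomial [m], by cases on whether its degree is below, above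
    or equal to 1; above 1 both sides have coefficient zero. *)
Lemma mpoly_affineE (R : nzRingType) (n : nat) (P : {mpoly R[n]}) :
  (msize P <= 2)%N -> P = (P@_0)%:MP + \sum_(i < n) P@_(U_(i)%MM) *: 'X_i.
Proof.
move=> leP2; apply/mpolyP => m.
rewrite mcoeffD mcoeffC raddf_sum /=.
under eq_bigr do rewrite mcoeffZ mcoeffX.
have [m_le0|m_ge2|/eqP/mdeg1P[j /eqP ->]] := ltngtP (mdeg m) 1.
- move: m_le0; rewrite ltnS leqn0 mdeg_eq0 => /eqP ->.
  rewrite eqxx mulr1 big1 ?addr0// => i _.
  by rewrite -mdeg_eq0 mdeg1 mulr0.
- have neq_m m' : (mdeg m' <= 1)%N -> (m' == m) = false.
    by move=> m'_le1; apply: contraTF m_ge2 => /eqP <-; rewrite -leqNgt.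
  rewrite eq_sym neq_m ?mdeg0// mulr0 add0r big1 => [|i _].
    by apply: memN_msupp_eq0; apply: contraTN m_ge2 => /msize_mdeg_lt; lia.
  by rewrite neq_m ?mdeg1// mulr0.
- rewrite -mdeg_eq0 mdeg1 mulr0 add0r (bigD1 j)//= eqxx mulr1.
  rewrite big1 ?addr0// => i neq_ij.
  by rewrite eq_mnm1 (negPf neq_ij) mulr0.
Qed.

(** The coefficients form a sequence on [nat], so that later index shifts need no ordinals. *)
Lemma polyfun_affine (R : idomainType) (n : nat) (p : {ffun 'I_n -> R} -> R) :
  polyfun_degree_le 1 p ->
  exists c, exists a : nat -> R, forall x, p x = c + \sum_(i < n) a i * x i.
Proof.
(* [inord] needs a nonempty index type, hence the separate case [n = 0]. *)
case: n p => [|n] p [P leP2 pE].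
  exists P@_0, (fun=> 0) => x; rewrite pE {1}(mpoly_affineE leP2) !big_ord0.
  by rewrite !addr0 mevalC.
exists P@_0, (fun i => P@_(U_(inord i)%MM)) => x.
rewrite pE {1}(mpoly_affineE leP2) mevalD mevalC raddf_sum /=.
by congr (_ + _); apply: eq_bigr => i _; rewrite mevalZ mevalXU inord_val.
Qed.

Section AffineOperations.
Variables (R : comNzRingType) (n : nat) (f : {ffun 'I_n -> R} -> R).
Variables (c : R) (a : nat -> R).
Hypothesis fE : forall x, f x = c + \sum_(i < n) a i * x i.

Lemma affine_nat (y : nat -> R) :
  f [ffun k : 'I_n => y k] = c + \sum_(0 <= k < n) a k * y k.
Proof. by rewrite fE big_mkord; under eq_bigr do rewrite ffunE. Qed.

(** The outer variables before the inner block keep their index, those of the block are shifted by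
    [i], and those after it by [n.-1], since the block fills [n] places but counts as one
    argument. *)
Lemma affine_nary_nest (i : nat) (y : nat -> R) : (i < n)%N ->
  nary_nest f i [ffun k : 'I_(2 * n.-1).+1 => y k] =
  c + (\sum_(0 <= j < i) a j * y j
       + (a i * (c + \sum_(0 <= k < n) a k * y (k + i)%N)
          + \sum_(i.+1 <= j < n) a j * y (j + n.-1)%N)).
Proof.
move=> lt_in; rewrite /nary_nest.
have -> : [ffun k : 'I_n => [ffun l : 'I_(2 * n.-1).+1 => y l] (inord (i + k))]
    = [ffun k : 'I_n => y (k + i)%N].
  by apply/ffunP => k; rewrite !ffunE addnC inordK//; have := ltn_ord k; lia.
rewrite (affine_nat (fun k => y (k + i)%N)).
set z := c + \sum_(0 <= k < n) _.
pose g j := if (j < i)%N then y j else if j == i then z else y (j + n.-1)%N.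
transitivity (f [ffun j : 'I_n => g j]).
  congr f; apply/ffunP => j; rewrite !ffunE /g.
  by case: (ltngtP j i) => //= ij; rewrite inordK//; have := ltn_ord j; lia.
rewrite affine_nat (big_cat_nat (n := i))//=; last exact: ltnW.
rewrite [X in _ + (_ + X)]big_ltn// {2}/g ltnn eqxx.
congr (_ + (_ + (_ + _))); apply: eq_big_nat => j; rewrite /g.
  by case/andP => _ ->.
by case/andP => lt_ij _; rewrite ltnNge ltnW//= gtn_eqF.
Qed.

(** Evaluates the shifted sums of a nested composition at the [m]-th unit vector. *)
Lemma sum_delta (l h s m : nat) :
  \sum_(l <= j < h) a j * ((j + s)%N == m)%:R =
  if (l + s <= m < h + s)%N then a (m - s)%N else 0.
Proof.
case: ifP => [mP|mP].
  rewrite (bigD1_seq (m - s)%N) ?mem_index_iota ?iota_uniq//=; last lia.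
  rewrite big1 => [|j neq_j]; last by rewrite (_ : _ == _ = false) ?mulr0//; lia.
  by rewrite subnK ?eqxx ?mulr1 ?addr0//; lia.
rewrite big_nat big1 // => j lj; rewrite (_ : _ == _ = false) ?mulr0//; lia.
Qed.

Lemma sum_delta0 (l h m : nat) :
  \sum_(l <= j < h) a j * (j == m)%:R = if (l <= m < h)%N then a m else 0.
Proof.
by have := sum_delta l h 0 m; under eq_bigr do rewrite addn0; rewrite !addn0 subn0.
Qed.

Lemma affine_associative_coef : (2 <= n)%N -> nary_associative f ->
  [/\ a 0%N * a 0%N = a 0%N, a 1%N * a n.-1 = a 1%N, a 0%N * c = a 1%N * c &
      forall k, (k.+1 < n)%N -> a 0%N * a k.+1 = a 1%N * a k].
Proof.
move=> n_ge2 /(_ 0%N n_ge2) assoc.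
have nest01 y := affine_nary_nest y (ltnW n_ge2).
have nest1 y := affine_nary_nest y n_ge2.
have eq_nest y : _ = _ := etrans (esym (nest01 y)) (etrans (assoc _) (nest1 y)).
have a0c : a 0%N * c = a 1%N * c.
  (* The zero vector isolates the constant terms; the unit vectors then give one coefficient
     each. *)
  have := eq_nest (fun=> 0).
  rewrite !big1; do ?by move=> *; rewrite mulr0.
  by rewrite !(addr0, add0r) => /addrI.
have eq_coef m := eq_nest (fun k => (k == m)%:R).
split=> // [||k lt_kn].
- have := eq_coef 0%N; rewrite !sum_delta !sum_delta0.
  do ![(rewrite ifT; last by lia) || (rewrite ifF; last by lia)].
  rewrite !(addr0, add0r) subn0 => /addrI.
  by rewrite mulrDr a0c addrC => /addIr.
(* Variable [n] is the first one after the inner block at position 0 and the last one in the block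
   at position 1. *)
- have := eq_coef n; rewrite !sum_delta !sum_delta0.
  do ![(rewrite ifT; last by lia) || (rewrite ifF; last by lia)].
  rewrite !(addr0, add0r) => /addrI; rewrite mulrDr a0c => /addrI.
  by rewrite subn1 (_ : n - n.-1 = 1)%N; last lia.
- have := eq_coef k.+1; rewrite !sum_delta !sum_delta0.
  do ![(rewrite ifT; last by lia) || (rewrite ifF; last by lia)].
  rewrite !(addr0, add0r) subn0 subn1 => /addrI.
  by rewrite !mulrDr a0c => /addrI.
Qed.

(** The right-hand side is free of [i], which gives associativity. The inner block carries the
    factor [w ^+ i], matching its shift and fixing [c]; after the block the shift by [n.-1] is
    invisible because [w ^+ n.-1 = 1]. *)
Lemma geometric_nary_nest (w : R) (i : nat) (y : nat -> R) :
    (forall k, a k = w ^+ k) -> w ^+ n.-1 = 1 -> w * c = c -> (i < n)%N ->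
  nary_nest f i [ffun k : 'I_(2 * n.-1).+1 => y k] =
  c + (c + \sum_(0 <= m < (2 * n.-1).+1) w ^+ m * y m).
Proof.
move=> aE w1 wc lt_in; rewrite affine_nary_nest//; congr (_ + _).
have wkc k : w ^+ k * c = c.
  by elim: k => [|k IHk]; rewrite ?mul1r// exprSr -mulrA wc.
rewrite aE mulrDr wkc (big_cat_nat (n := i) (p := (2 * n.-1).+1))//=; last lia.
rewrite (big_cat_nat (n := (i + n)%N) (m := i) (p := (2 * n.-1).+1))//=; try lia.
have -> : \sum_(i <= m < i + n) w ^+ m * y m =
    w ^+ i * \sum_(0 <= k < n) a k * y (k + i)%N.
  rewrite -{1}[i]add0n big_addn addKn big_distrr.
  by apply: eq_bigr => k _; rewrite aE exprD /=; ring.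
have -> : \sum_(i + n <= m < (2 * n.-1).+1) w ^+ m * y m =
    \sum_(i.+1 <= j < n) a j * y (j + n.-1)%N.
  rewrite (_ : i + n = i.+1 + n.-1)%N; last lia.
  rewrite big_addn (_ : (2 * n.-1).+1 - n.-1 = n)%N; last lia.
  by apply: eq_bigr => j _; rewrite aE exprD w1 mulr1.
under eq_bigr do rewrite aE.
by rewrite -addrA [LHS]addrCA.
Qed.

Lemma geometric_nary_group (w : R) : (2 <= n)%N ->
    (forall k, a k = w ^+ k) -> w ^+ n.-1 = 1 -> w * c = c ->
  nary_group f.
Proof.
move=> n_ge2 aE w1 wc; split=> [x b i|i lt_in x]; last first.
  have -> : x = [ffun k : 'I_(2 * n.-1).+1 => x (inord k)].
    by apply/ffunP => k; rewrite ffunE inord_val.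
  by rewrite !(geometric_nary_nest (fun k => x (inord k)) aE)//; lia.
(* An inverse of [w ^+ i] with a natural exponent, as [i <= n.-1 * i]; it solves the equation in the
   [i]-th variable. *)
have wi1 : w ^+ (n.-1 * i - i) * w ^+ i = 1.
  by rewrite -exprD subnK ?exprM ?w1 ?expr1n//; nia.
have fE' z : f [ffun j => if j == i then z else x j] =
    c + (w ^+ i * z + \sum_(j < n | j != i) a j * x j).
  rewrite fE (bigD1 i)//= ffunE eqxx aE; congr (_ + (_ + _)).
  by apply: eq_bigr => j /negPf ij; rewrite ffunE ij.
set s := \sum_(j < n | j != i) a j * x j in fE'.
exists (w ^+ (n.-1 * i - i) * (b - c - s)); split.
  by rewrite fE' mulrA [w ^+ i * _]mulrC wi1; ring.
move=> z; rewrite fE' => <-.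
transitivity (w ^+ (n.-1 * i - i) * w ^+ i * z); last by rewrite wi1 mul1r.
ring.
Qed.

Lemma affine_skew (x y : R) : (0 < n)%N ->
  nary_skew f x y <-> c + ((\sum_(i < n.-1) a i) * x + a n.-1 * y) = x.
Proof.
case: n f fE => // m g gE _; rewrite /nary_skew gE big_ord_recr/= ffunE eqxx.
under eq_bigr => i _ do rewrite ffunE/= eqSS ltn_eqF//.
by rewrite mulr_suml.
Qed.
End AffineOperations.

(** Unique solvability makes every coefficient nonzero, so the relations forced by associativity can
    be cancelled in the domain. *)
Lemma affine_nary_group_geometric (R : idomainType) (n : nat)
    (f : {ffun 'I_n -> R} -> R) (c : R) (a : nat -> R) :
    (2 <= n)%N -> (forall x, f x = c + \sum_(i < n) a i * x i) ->
    nary_group f ->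
  exists w, [/\ w ^+ n.-1 = 1, w * c = c &
                forall x, f x = c + \sum_(i < n) w ^+ i * x i].
Proof.
move=> n_ge2 fE [quasi assoc].
have [a00 a1n a0c aS] := affine_associative_coef fE n_ge2 assoc.
have a_neq0 (i : 'I_n) : a i != 0.
  (* If [a i = 0], then [f (u z)] does not depend on [z], so 0 and 1 would solve the same
     equation. *)
  apply/eqP => ai0; pose u z : {ffun 'I_n -> R} :=
    [ffun j => if j == i then z else [ffun=> 0] j].
  have [z [_ uniq_z]] := quasi [ffun=> 0] (f (u 0)) i.
  have fu t : f (u t) = f (u 0).
    rewrite !fE; congr (_ + _); apply: eq_bigr => j _; rewrite !ffunE.
    by case: eqP => // ->; rewrite ai0 !mul0r.
  have := uniq_z 1 (fu 1); rewrite (uniq_z 0 (fu 0)).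
  by move/esym/eqP; rewrite oner_eq0.
have a0 : a 0%N = 1.
  have := a_neq0 (Ordinal (ltnW n_ge2)) => /= /mulfI; apply.
  by rewrite a00 mulr1.
have an1 : a n.-1 = 1.
  have := a_neq0 (Ordinal n_ge2) => /= /mulfI; apply.
  by rewrite a1n mulr1.
have aE k : (k < n)%N -> a k = a 1%N ^+ k.
  elim: k => // k IHk lt_kn; rewrite exprS -IHk; last exact: ltnW.
  by rewrite -aS// a0 mul1r.
exists (a 1%N); split=> [||x]; first by rewrite -aE//; lia.
  by rewrite -a0c a0 mul1r.
by rewrite fE; under eq_bigr => i _ do rewrite aE//.
Qed.

Theorem proposition11 (R : idomainType) (n : nat)
    (infR : infinite_set [set: R]%classic) (n_ge2 : (2 <= n)%N)
    (p : {ffun 'I_n -> R} -> R) (p_le1 : polyfun_degree_le 1 p) :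
  [/\ (nary_group p <->
       (exists c : R, forall x, p x = c + \sum_(i < n) x i) \/
       (exists omega : R,
          [/\ (3 <= n)%N, omega != 1, omega ^+ n.-1 = 1 &
              forall x, p x = \sum_(i < n) omega ^+ i * x i])),
      (forall c : R, (forall x, p x = c + \sum_(i < n) x i) ->
       forall x y : R, nary_skew p x y <-> y = (2 - n%:R) * x - c) &
      (forall omega : R, (3 <= n)%N -> omega != 1 -> omega ^+ n.-1 = 1 ->
       (forall x, p x = \sum_(i < n) omega ^+ i * x i) ->
       forall x y : R, nary_skew p x y <-> y = x)].
Proof.
(* Both types become instances of one form: type (iv) has ratio 1, type (v) has constant 0. *)
have type4 c (x : {ffun 'I_n -> R}) :
    c + \sum_(i < n) x i = c + \sum_(i < n) 1 ^+ i * x i.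
  by under [in RHS]eq_bigr do rewrite expr1n mul1r.
have type5 w (x : {ffun 'I_n -> R}) :
    \sum_(i < n) w ^+ i * x i = 0 + \sum_(i < n) w ^+ i * x i.
  by rewrite add0r.
split; first split.
- have [c [a pE]] := polyfun_affine p_le1.
  move=> /(affine_nary_group_geometric n_ge2 pE)[w [w1 wc pE']].
  have [w_eq1|w_neq1] := eqVneq w 1.
    by left; exists c => x; rewrite pE' w_eq1 -type4.
  right; exists w; split=> // [|x].
    (* For [n = 2] the equation [w ^+ n.-1 = 1] reads [w = 1], which is excluded. *)
    case: n n_ge2 w1 {p p_le1 pE pE' type4 type5} => [|[|[|m]]]//= _.
    by rewrite expr1 => w_eq1; rewrite w_eq1 eqxx in w_neq1.
  (* Here [(w - 1) * c = 0] with [w != 1] in a domain. *)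
  suff c0 : c = 0 by rewrite pE' c0 -type5.
  apply/eqP; move/eqP: wc.
  by rewrite -subr_eq0 -{2}[c]mul1r -mulrBl mulf_eq0 subr_eq0 (negPf w_neq1).
- case=> [[c pE]|[w [_ _ w1 pE]]].
    apply: (@geometric_nary_group _ _ _ c (fun k => 1 ^+ k) _ 1) => //.
    - by move=> x; rewrite pE type4.
    - by rewrite expr1n.
    - by rewrite mul1r.
  apply: (@geometric_nary_group _ _ _ 0 (fun k => w ^+ k) _ w) => //.
  - by move=> x; rewrite pE -type5.
  - by rewrite mulr0.
- move=> c pE x y.
  have pE' z : p z = c + \sum_(i < n) 1 ^+ i * z i by rewrite pE type4.
  rewrite (affine_skew pE')//; last exact: ltnW.
  under eq_bigr do rewrite expr1n.
  rewrite sumr_const card_ord expr1n mul1r.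
  have -> : n%:R = n.-1%:R + 1 :> R by rewrite natr1 prednK// ltnW.
  split=> [E|->]; last by ring.
  have -> : y = c + (n.-1%:R * x + y) - n.-1%:R * x - c by ring.
  by rewrite E; ring.
- move=> w _ w_neq1 w1 pE x y.
  have pE' z : p z = 0 + \sum_(i < n) w ^+ i * z i by rewrite pE -type5.
  rewrite (affine_skew pE')//; last exact: ltnW.
  (* Geometric sum: multiplied by [w - 1], which is nonzero, it becomes [w ^+ n.-1 - 1 = 0]. *)
  have -> : \sum_(i < n.-1) w ^+ i = 0.
    apply/eqP; have := subrX1 w n.-1; rewrite w1 subrr => /esym/eqP.
    by rewrite mulf_eq0 subr_eq0 (negPf w_neq1).
  by rewrite w1 mul0r mul1r !add0r.
Qed.
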